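(* Let $G$ be an $n$-vertex, $K_{r+1}$-free graph where $r \ge 3$. For every $k \ge 0$, if $G$ is not $k$-path Hamiltonian and \[n \ge \begin{cases} 6k+26 & \text{if } r=3\\ 5k+11 & \text{if } 4 \le r \le 7\\ k+5+ 4(k+4)/(r-4) & \text{if } r \ge 8\end{cases},\] then $e(G) \leq e(T_r(n-1)) + (k+1)$. The set $\mathcal{J}^k_{n,r}$ is nonempty, and equality holds if $G \in \mathcal{J}^k_{n,r}$.
   Context: Graphs are simple. $e(G)$ is the number of edges of $G$. $T_r(n)$ is the Turán graph: the $n$-vertex complete $r$-partite graph with parts as balanced as possible (so $T_r(n)=K_n$ if $n\le r$). An $n$-vertex graph is $k$-path Hamiltonian ($0\le k\le n-2$) if every path of length at most $k$ (length = number of edges) is contained in a Hamiltonian cycle. A graph is traceable if it has a Hamiltonian path. $\mathcal{J}^{k}_{n,r}$ is the set of $n$-vertex, $K_{r+1}$-free graphs consisting of $T_r(n-1)$ plus one additional vertex of degree $k+1$ whose neighborhood induces a traceable graph (equivalently, each part of the $T_r(n-1)$ contains at most $(k+2)/2$ of its neighbors). *)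

(* Defs.v *)
From mathcomp Require Import all_boot all_order all_algebra.

Set Implicit Arguments.
Unset Strict Implicit.
Unset Printing Implicit Defensive.

Record sgraph := SGraph {
  vertex :> finType;
  adj : rel vertex;
  adj_sym : symmetric adj;
  adj_irr : irreflexive adj
}.

Definition edge_set (G : sgraph) : {set {set G}} :=
  [set [set p.1; p.2] | p : G * G & adj p.1 p.2].

Definition num_edges (G : sgraph) : nat := #|edge_set G|.

Definition nbhd (G : sgraph) (v : G) : {set G} := [set x | adj v x].

Definition is_clique (G : sgraph) (A : {set G}) : Prop :=
  {in A &, forall x y, x != y -> adj x y}.

(* G is K_m-free. *)
Definition clique_free (m : nat) (G : sgraph) : Prop :=
  forall A : {set G}, is_clique A -> #|A| <> m.

Definition induced_adj (G : sgraph) (A : {set G}) : rel {x : G | x \in A} :=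
  fun x y => adj (val x) (val y).

Lemma induced_sym (G : sgraph) (A : {set G}) : symmetric (induced_adj (A := A)).
Proof. by move=> x y; apply: adj_sym. Qed.

Lemma induced_irr (G : sgraph) (A : {set G}) :
  irreflexive (induced_adj (A := A)).
Proof. by move=> x; apply: adj_irr. Qed.

Definition induced (G : sgraph) (A : {set G}) : sgraph :=
  SGraph (@induced_sym G A) (@induced_irr G A).

Definition isomorphic (G H : sgraph) : Prop :=
  exists2 f : G -> H, bijective f & forall x y, adj (f x) (f y) = adj x y.

(* The parts are the residue classes modulo r, whose sizes in {0, ..., n-1}
   pairwise differ by at most one (r is always positive below). *)
Definition turan_adj (r n : nat) : rel 'I_n := fun i j => i %% r != j %% r.

Lemma turan_sym (r n : nat) : symmetric (@turan_adj r n).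
Proof. by move=> i j; rewrite /turan_adj eq_sym. Qed.

Lemma turan_irr (r n : nat) : irreflexive (@turan_adj r n).
Proof. by move=> i; rewrite /turan_adj eqxx. Qed.

Definition turan (r n : nat) : sgraph :=
  SGraph (@turan_sym r n) (@turan_irr r n).

(* A path is given by its first vertex x and the sequence p of the following
   ones, so its length (number of edges) is size p. *)
Definition is_path (G : sgraph) (x : G) (p : seq G) : Prop :=
  path (@adj G) x p /\ uniq (x :: p).

Definition traceable (G : sgraph) : Prop :=
  exists (x : G) (p : seq G), is_path x p /\ forall y : G, y \in x :: p.

(* The size condition excludes the degenerate cycles of ucycle. *)
Definition hamiltonian_cycle (G : sgraph) (c : seq G) : Prop :=
  [/\ ucycle (@adj G) c, 2 < size c & forall y : G, y \in c].

Definition cycle_edge (G : sgraph) (c : seq G) : rel G :=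
  fun x y => [&& x \in c, y \in c & (next c x == y) || (next c y == x)].

(* The path x :: p is a subgraph of the cycle c; the first condition only
   matters for paths of length 0. *)
Definition path_in_cycle (G : sgraph) (x : G) (p c : seq G) : Prop :=
  x \in c /\ path (cycle_edge c) x p.

(* Meaningful for k <= n - 2, where n is the number of vertices of G. *)
Definition path_hamiltonian (k : nat) (G : sgraph) : Prop :=
  forall (x : G) (p : seq G), is_path x p -> size p <= k ->
    exists2 c : seq G, hamiltonian_cycle c & path_in_cycle x p c.

Definition extremal_family (k n r : nat) (G : sgraph) : Prop :=
  [/\ #|G| = n, clique_free r.+1 G &
      exists v : G,
        [/\ isomorphic (induced [set~ v]) (turan r n.-1),
            #|nbhd v| = k.+1 &
            traceable (induced (nbhd v))]].

(* The second and third cases are 4 <= r <= 7 and r >= 8, as r is always at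
   least 3. *)
Definition order_bound (r k : nat) : rat :=
  (if (r == 3)%N then 6 * k%:R + 26
   else if (r <= 7)%N then 5 * k%:R + 11
   else k%:R + 5 + 4 * (k%:R + 4) / (r%:R - 4))%R.

(* Main.v *)
Require Import Defs.
From mathcomp Require Import all_boot all_order all_algebra.
From mathcomp Require Import zify.

(** Suppose that [G] is not [k]-path Hamiltonian.  A closure argument in the
    style of Posa and Chvatal ([posa_condition]) gives some [s >= 1] with
    [2 * s + k < n] such that [s] vertices have degree at most [s + k].  Deleting
    them leaves a K_(r+1)-free graph on [n - s] vertices, so by Turan's theorem
    [G] has at most [t_r(n - s) + s * (s + k)] edges ([low_degree_edges]).  For
    [s = 1] this is the claimed bound.  As a function of [s] the expression is
    essentially a convex quadratic polynomial, hence largest at the ends of the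
    range of [s], and the lower bounds on [n] are chosen so that [s = 1] wins.

    For [r = 3] this fails when [s] is close to [n / 2]: to leading order both
    ends give the same value.  The estimate is wasteful there, because it lets
    every vertex of the low-degree set [S] spend its whole degree on the
    complement of [S].  That complement cannot be nearly extremal while the
    vertices of [S] see more than about two thirds of it: each of them misses a
    vertex of every triangle.  A maximal packing of disjoint triangles in the
    complement makes this precise ([triangle_packing], [low_degree_edges_K4]).

    For the converse, let [v] be a vertex of degree [k + 1] with a traceable
    neighbourhood.  A cycle containing [v] and a Hamiltonian path of this
    neighbourhood closes up after [k + 2] vertices ([short_cycle]), so it is not
    Hamiltonian.  A graph of the extremal family is obtained from the Turan graph
    by joining a new vertex to the first [k + 1] vertices outside one residue
    class ([extremal_family_nonempty]). *)

Set Implicit Arguments.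
Unset Strict Implicit.
Unset Printing Implicit Defensive.

Import GRing.Theory Num.Theory.

(** * Turan numbers *)

(** The number of edges of the Turan graph, written as the sum of the degrees
    that its vertices have when they are added one at a time: vertex [i] misses
    the [i %/ r] earlier vertices of its own residue class. *)
Definition turan_number (r m : nat) : nat := \sum_(i < m) (i - i %/ r).

Lemma turan_numberS r m :
  turan_number r m.+1 = turan_number r m + (m - m %/ r).
Proof. by rewrite /turan_number big_ord_recr. Qed.

Lemma modn_succ_dvdn r m : 0 < r -> r %| m.+1 -> (m %% r).+1 = r.
Proof.
move=> r0 /eqP; rewrite -addn1 -modnDml addn1 => h.
move: (ltn_pmod m r0); rewrite leq_eqVlt => /orP[/eqP //|lt].
by move: h; rewrite modn_small.
Qed.

(** The quadratic main term with its exact rounding error.  For [r <= 4] the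
    error is at most [1/2] after division by [2 * r], so that integrality
    absorbs it. *)
Lemma turan_number_formula r m : 0 < r ->
  2 * r * turan_number r m + (m %% r) * (r - m %% r) = r.-1 * m ^ 2.
Proof.
move=> r0; elim: m => [|m IH].
  by rewrite /turan_number big_ord0 mod0n !muln0.
rewrite turan_numberS modnS.
have := divn_eq m r; have := ltn_pmod m r0.
case: ifP => [dv|ndv].
  have := modn_succ_dvdn r0 dv.
  move: (m %% r) (m %/ r) IH => a q IH rE _ mE; subst m; subst r.
  have -> : q * a.+1 + a - q = q * a + a by lia.
  have e : a.+1 - a = 1 by lia.
  rewrite /= e -!mulnn in IH *; lia.
have : (m %% r).+1 != r.
  apply: contraFN ndv => /eqP h.
  by rewrite /dvdn -addn1 -modnDml addn1 h modnn.
move: (m %% r) (m %/ r) IH => a q IH /eqP ne ar mE.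
have [b rE] : exists b, r = a + b + 2.
  by exists (r - a - 2); lia.
subst r; subst m.
have -> : a + b + 2 - a.+1 = b + 1 by lia.
move: IH; have -> : a + b + 2 - a = b + 2 by lia.
have -> : (a + b + 2).-1 = a + b + 1 by lia.
set X := turan_number _ _ => IH.
have -> : q * (a + b + 2) + a - q = q * (a + b + 1) + a by lia.
rewrite -!mulnn in IH *; lia.
Qed.

Lemma turan_number_le r m : 0 < r -> 2 * r * turan_number r m <= r.-1 * m ^ 2.
Proof. by move=> r0; rewrite -(turan_number_formula m r0) leq_addr. Qed.

(** The rounding is done here on each increment, not on the two Turan
    numbers, whose error of order [r] would be too large for large [r]. *)
Lemma turan_number_increment r m j : 0 < r ->
  2 * r * turan_number r m + r.-1 * (j * (2 * m + j.-1))
    <= 2 * r * turan_number r (m + j).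
Proof.
move=> r0; elim: j => [|j IH]; first by rewrite mul0n muln0 !addn0.
rewrite addnS turan_numberS [leqRHS]mulnDr.
have h : r * ((m + j) %/ r) <= m + j by rewrite mulnC leq_trunc_div.
have {h} h : r.-1 * (m + j) <= r * (m + j - (m + j) %/ r).
  by rewrite mulnBr -subn1 mulnBl mul1n leq_sub2l.
have e : j.+1 * (2 * m + j.+1.-1) = j * (2 * m + j.-1) + 2 * (m + j).
  by case: j {IH h} => [|j] /=; lia.
rewrite e mulnDr addnA; apply: leq_add => //.
by rewrite mulnCA -mulnA leq_mul2l.
Qed.

(** * Counting edges by degrees, and Turan's theorem *)

Section Arcs.
Variable G : sgraph.
Implicit Types (A B S T : {set G}) (v : G).

Definition deg_in B v : nat := \sum_(y in B) (adj v y : nat).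

(** Ordered pairs are counted, so that edges inside [A :&: B] count
    twice and the number of edges inside [B] is half of [arcs B B]. *)
Definition arcs A B : nat := \sum_(x in A) deg_in B x.

Lemma arcsC A B : arcs A B = arcs B A.
Proof.
rewrite /arcs /deg_in exchange_big /=.
by apply: eq_bigr => y _; apply: eq_bigr => x _; rewrite adj_sym.
Qed.

Lemma deg_inE B v : deg_in B v = #|[set y in B | adj v y]|.
Proof.
rewrite /deg_in -sum1dep_card [RHS]big_mkcondr.
by apply: eq_bigr => y _; case: (adj v y).
Qed.

Lemma deg_in_setT v : deg_in setT v = #|nbhd v|.
Proof. by rewrite deg_inE; apply: eq_card => y; rewrite !inE. Qed.

Lemma deg_in_le B v : deg_in B v <= #|B|.
Proof. by rewrite deg_inE subset_leq_card //; apply/subsetP=> y /[!inE]/andP[]. Qed.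

Lemma deg_in_split S B v : S \subset B ->
  deg_in B v = deg_in S v + deg_in (B :\: S) v.
Proof. by move=> sSB; rewrite /deg_in (big_setID S) /= (setIidPr sSB). Qed.

Lemma arcs_splitl S A B : S \subset A ->
  arcs A B = arcs S B + arcs (A :\: S) B.
Proof. by move=> sSA; rewrite /arcs (big_setID S) /= (setIidPr sSA). Qed.

Lemma arcs_splitr S A B : S \subset B ->
  arcs A B = arcs A S + arcs A (B :\: S).
Proof. by move=> sSB; rewrite arcsC (arcs_splitl _ sSB) arcsC (arcsC _ A). Qed.

Lemma arcs_split S B : S \subset B ->
  arcs B B = arcs S S + 2 * arcs S (B :\: S) + arcs (B :\: S) (B :\: S).
Proof.
move=> sSB; rewrite (arcs_splitl _ sSB) !(arcs_splitr _ sSB) (arcsC _ S); lia.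
Qed.

Lemma arcs_set1 v B : arcs [set v] B = deg_in B v.
Proof. by rewrite /arcs big_set1. Qed.

Lemma handshake : 2 * num_edges G = arcs setT setT.
Proof.
have -> : arcs setT setT = #|[set p : G * G | adj p.1 p.2]|.
  rewrite /arcs /deg_in pair_big_dep -sum1dep_card [RHS]big_mkcond /=.
  apply: eq_big => [p|p _]; first by rewrite !inE.
  by case: (adj p.1 p.2).
rewrite -sum1_card (partition_big_imset (fun p : G * G => [set p.1; p.2])) /=.
have -> : [set [set p.1; p.2] | p in [set p : G * G | adj p.1 p.2]] = edge_set G.
  apply/setP=> E; apply/imsetP/imsetP=> -[p pP ->]; exists p => //; move: pP; rewrite !inE //.
rewrite /num_edges mulnC -sum_nat_const; apply: eq_bigr.
move=> E /imsetP[[a b]]; rewrite inE /= => ab ->.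
have nab : a != b by apply: contraTneq ab => ->; rewrite adj_irr.
have eq2 : [set (a, b); (b, a)] =i [pred p | (p \in [set p : G * G | adj p.1 p.2]) && ([set p.1; p.2] == [set a; b])].
  move=> [x y]; rewrite !inE /= !xpair_eqE; apply/orP/andP.
    case=> /andP[/eqP-> /eqP->]; split=> //; first by rewrite adj_sym.
    by rewrite setUC.
  case=> xy /eqP/setP eqs; move: nab.
  have := eqs b; have := eqs a; rewrite !inE !eqxx orbT /=.
  by case/orP=> /eqP-> /orP[]/eqP->; rewrite !eqxx ?orbT //=; auto.
by rewrite sum1_card -(eq_card eq2) cards2 xpair_eqE negb_and nab.
Qed.

Lemma clique0 : is_clique (set0 : {set G}).
Proof. by move=> x y; rewrite inE. Qed.

Lemma clique_add A v : is_clique A -> {in A, forall x, adj x v} ->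
  is_clique (v |: A).
Proof.
move=> cA Av x y; rewrite !inE => /orP[/eqP->|xA] /orP[/eqP->|yA] ne.
- by rewrite eqxx in ne.
- by rewrite adj_sym Av.
- exact: Av.
- exact: cA.
Qed.

Lemma clique_add_card A v : {in A, forall x, adj x v} -> #|v |: A| = #|A|.+1.
Proof.
move=> Av; rewrite cardsU1; case vA: (v \in A) => //.
by have := Av v vA; rewrite adj_irr.
Qed.

(** A clique [A] with at most [r] elements can be extended: the vertices of
    [B] that miss some element of [A] number at most
    [\sum_(v in A) (#|B| - deg_in B v)], which is less than [#|B|]. *)
Lemma greedy_clique r B : 0 < r -> 0 < #|B| ->
  {in B, forall v, r * (#|B| - deg_in B v) < #|B|} ->
  forall j, j <= r.+1 -> exists A, [/\ A \subset B, is_clique A & #|A| = j].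
Proof.
move=> r0 B0 degB; elim=> [|j IH] jr.
  by exists set0; rewrite sub0set cards0; split=> //; apply: clique0.
have [A [sAB cA Aj]] := IH (ltnW jr).
have [|nex] := boolP [exists y in B, [forall x in A, adj x y]].
  case/exists_inP=> y yB /forall_inP Ay.
  exists (y |: A); split; first by rewrite subUset sub1set yB.
  - exact: clique_add.
  - by rewrite clique_add_card // Aj.
have : #|B| <= \sum_(v in A) (#|B| - deg_in B v).
  have -> : \sum_(v in A) (#|B| - deg_in B v)
            = \sum_(v in A) \sum_(y in B) (~~ adj v y : nat).
    apply: eq_bigr => v _; rewrite -sum1_card /deg_in -sumnB; last by move=> y _; case: adj.
    by apply: eq_bigr => y _; case: adj.
  rewrite exchange_big /= -sum1_card; apply: leq_sum => y yB.
  move: nex; rewrite negb_exists_in => /forall_inP/(_ y yB).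
  rewrite negb_forall_in => /exists_inP[x xA nxy].
  by rewrite (bigD1 x) //= nxy.
rewrite -(leq_pmul2l r0) big_distrr /= => le1.
have le2 : \sum_(v in A) r * (#|B| - deg_in B v) <= \sum_(v in A) #|B|.-1.
  by apply: leq_sum => v vA; have := degB v (subsetP sAB v vA); case: #|B|.
rewrite sum_nat_const Aj in le2.
have : r * #|B| <= r * #|B|.-1.
  by rewrite (leq_trans le1) // (leq_trans le2) // leq_mul2r -ltnS jr orbT.
by rewrite leq_pmul2l // leqNgt prednK // leqnn.
Qed.

(** Induction on [#|B|].  Without a clique of size [r.+1] the greedy
    construction fails, so some vertex has degree at most [m - m %/ r], where
    [m = #|B| - 1]; this is the last increment of the Turan number. *)
Lemma turan_theorem r B : 0 < r ->
  (forall A, A \subset B -> is_clique A -> #|A| <> r.+1) ->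
  arcs B B <= 2 * turan_number r #|B|.
Proof.
move=> r0; have [m] := ubnP #|B|; elim: m B => // m IH B; rewrite ltnS => Bm free.
have [->|B0] := set_0Vmem B; first by rewrite /arcs big_set0.
have {}B0 : 0 < #|B| by case: B0 => v vB; apply/card_gt0P; exists v.
have [/forall_inP h|] := boolP [forall v in B, r * (#|B| - deg_in B v) < #|B|].
  have [A [sAB cA Ar]] := greedy_clique r0 B0 h (leqnn _).
  by case: (free A sAB cA).
rewrite negb_forall_in => /exists_inP[v vB]; rewrite -leqNgt => low.
have sv : [set v] \subset B by rewrite sub1set.
have BE := cardsD1 v B; rewrite vB add1n in BE.
have le1 : arcs (B :\ v) (B :\ v) <= 2 * turan_number r #|B :\ v|.
  apply: IH; first by rewrite -BE.
  by move=> A sA; apply: free; apply: subset_trans sA (subsetDl _ _).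
rewrite (arcs_split sv) !arcs_set1 BE turan_numberS.
have -> : deg_in [set v] v = 0 by rewrite /deg_in big_set1 adj_irr.
have -> : deg_in (B :\ v) v = deg_in B v.
  by rewrite (deg_in_split v sv) /deg_in big_set1 adj_irr.
suff : deg_in B v <= #|B :\ v| - #|B :\ v| %/ r by lia.
have h1 : r * (#|B :\ v| %/ r) < r * (#|B| - deg_in B v).
  by rewrite (leq_trans _ low) // BE ltnS mulnC leq_trunc_div.
rewrite ltn_pmul2l // in h1; lia.
Qed.

End Arcs.

(** * The number of edges of the Turan graph *)

Lemma residue_count r a m : a < r ->
  \sum_(j < m) (j %% r == a : nat) = m %/ r + (a < m %% r).
Proof.
move=> ar; have r0 : 0 < r by lia.
elim: m => [|m IH]; first by rewrite big_ord0 div0n mod0n.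
rewrite big_ord_recr /= IH divnS // modnS.
have := divn_eq m r; have := ltn_pmod m r0.
case: ifP => [dv|ndv] /=.
  have := modn_succ_dvdn r0 dv.
  by lia.
lia.
Qed.

Lemma arcs_turan r m : 0 < r ->
  arcs (G := turan r m) setT setT = 2 * turan_number r m.
Proof.
move=> r0.
have -> : arcs (G := turan r m) setT setT = \sum_(i < m) \sum_(j < m) (i %% r != j %% r : nat).
  rewrite /arcs /deg_in; apply: eq_big => [i|i _]; first by rewrite inE.
  by apply: eq_big => [j|j _]; first by rewrite inE.
elim: m => [|m IH]; first by rewrite /turan_number !big_ord0.
rewrite big_ord_recr /= big_ord_recr /= eqxx addn0.
rewrite (eq_bigr (fun i : 'I_m => \sum_(j < m) (i %% r != j %% r : nat) + (i %% r != m %% r))); last first.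
  by move=> i _; rewrite big_ord_recr.
rewrite big_split /= IH turan_numberS.
have cnt : \sum_(j < m) (j %% r != m %% r : nat) = m - m %/ r.
  have := residue_count m (ltn_pmod m r0); rewrite ltnn addn0 => <-.
  rewrite -[X in X - _](card_ord m) -sum1_card -sumnB; last by move=> i _; case: eqP.
  by apply: eq_bigr => i _; case: eqP.
rewrite cnt; under eq_bigr do rewrite eq_sym.
by rewrite cnt; lia.
Qed.

Lemma num_edges_turan r m : 0 < r -> num_edges (turan r m) = turan_number r m.
Proof. by move=> r0; have := arcs_turan m r0; rewrite -handshake; lia. Qed.

(** * Edge bounds from a set of vertices of low degree *)

Section LowDegree.
Variable G : sgraph.
Implicit Types (A B S T : {set G}) (v : G).

(** An edge between [S] and its complement is counted twice on the left.  One
    of the two counts goes into the degree sum of [S], together with the edges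
    inside [S]; the other one is left over, to be bounded by better means. *)
Lemma low_degree_split S d : {in S, forall v, #|nbhd v| <= d} ->
  2 * num_edges G <= arcs (~: S) (~: S) + arcs S (~: S) + #|S| * d.
Proof.
move=> lowS; rewrite handshake (arcs_split (subsetT S)) setTD.
have : arcs S S + arcs S (~: S) <= #|S| * d; last by lia.
rewrite -setTD -arcs_splitr ?subsetT // -sum_nat_const.
by apply: leq_sum => v vS; rewrite deg_in_setT lowS.
Qed.

Lemma low_degree_edges r S d : 0 < r -> clique_free r.+1 G ->
  {in S, forall v, #|nbhd v| <= d} ->
  num_edges G <= turan_number r (#|G| - #|S|) + #|S| * d.
Proof.
move=> r0 free lowS; have := low_degree_split lowS.
have : arcs S (~: S) <= #|S| * d.
  rewrite -sum_nat_const; apply: leq_sum => v vS.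
  rewrite (leq_trans _ (lowS v vS)) // -deg_in_setT.
  by rewrite (deg_in_split _ (subsetT (~: S))) leq_addr.
have := @turan_theorem G r (~: S) r0 (fun A _ => free A).
by rewrite cardsCs setCK; lia.
Qed.

(** Remove disjoint triangles as long as possible: [t] of them, leaving [u]
    triangle-free vertices.  In a K_4-free graph a vertex has at most two
    neighbours in each triangle, and Mantel's theorem bounds what is left.  The
    edge bound is [#|B|^2 / 3 - u^2 / 12], so a large [u], which weakens the
    degree bound [2 * t + u], is paid for by missing edges inside [B]. *)
Lemma triangle_packing B : clique_free 4 G ->
  exists t u, [/\ #|B| = 3 * t + u,
    2 * arcs B B <= 4 * (3 * (t * t) + 2 * (t * u)) + u * u
    & forall v, deg_in B v <= 2 * t + u].
Proof.
move=> free; have [m] := ubnP #|B|; elim: m B => // m IH B; rewrite ltnS => Bm.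
have [|noT] := boolP [exists T : {set G},
    [&& T \subset B, #|T| == 3 & [forall x in T, forall y in T, (x != y) ==> adj x y]]].
  case/existsP=> T /and3P[sTB /eqP T3 /forall_inP cT].
  have {}cT : is_clique T.
    by move=> x y xT yT ne; have /forall_inP/(_ y yT)/implyP := cT x xT; apply.
  have deg2 v : deg_in T v <= 2.
    rewrite -ltnS -T3 deg_inE ltnNge; apply/negP => le3.
    have Tv : {in T, forall x, adj x v}.
      have /eqP e : [set y in T | adj v y] == T.
        by rewrite eqEcard le3 andbT; apply/subsetP => y; rewrite inE => /andP[].
      by move=> x; rewrite -{1}e inE adj_sym => /andP[].
    by have := free _ (clique_add cT Tv); rewrite clique_add_card // T3.
  have BE : #|B| = #|B :\: T| + 3.
    by rewrite (cardsD B T) (setIidPr sTB) T3 subnK // -T3 subset_leq_card.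
  have [|t [u [cB aB dB]]] := IH (B :\: T); first by lia.
  exists t.+1, u; split; first by lia.
    rewrite (arcs_split sTB).
    have : arcs T T <= 6.
      by rewrite -[6]/(3 * 2) -T3 -sum_nat_const; apply: leq_sum.
    have : arcs T (B :\: T) <= #|B :\: T| * 2.
      by rewrite arcsC -sum_nat_const; apply: leq_sum.
    by rewrite cB; lia.
  by move=> v; rewrite (deg_in_split _ sTB); have := dB v; have := deg2 v; lia.
exists 0, #|B|; split=> //; last by move=> v; rewrite deg_in_le.
have : arcs B B <= 2 * turan_number 2 #|B|.
  apply: turan_theorem => // A sAB cA A3; case/existsP: noT; exists A.
  rewrite sAB A3 eqxx /=; apply/forall_inP => x xA; apply/forall_inP=> y yA.
  by apply/implyP; apply: cA.
by have := turan_number_le #|B| (isT : 0 < 2); rewrite /= -mulnn; lia.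
Qed.

(** With [b = #|~: S|] and [s = #|S|] the packing contributes
    [4 * b^2 - u^2 + 4 * s * b + 2 * s * u], and [2 * s * u - u^2 <= s^2]
    eliminates [u]. *)
Lemma low_degree_edges_K4 S d : clique_free 4 G ->
  {in S, forall v, #|nbhd v| <= d} ->
  12 * num_edges G <= 4 * (#|~: S| * #|~: S|) + 4 * (#|S| * #|~: S|)
                      + 6 * (#|S| * d) + #|S| * #|S|.
Proof.
move=> free lowS; have := low_degree_split lowS.
have [t [u [cB aB dB]]] := triangle_packing (~: S) free.
have : arcs S (~: S) <= #|S| * (2 * t + u).
  by rewrite -sum_nat_const; apply: leq_sum.
rewrite cB; move: (#|S|) (arcs _ _) (arcs _ _) aB => s a1 a2 h1 h2 h3.
have amgm : 2 * (s * u) <= s * s + u * u by have := (nat_Cauchy s u).1; rewrite -!mulnn.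
lia.
Qed.

End LowDegree.

(** * Comparing the bounds with the extremal number *)

(** Here and below the graph has [N.+1] vertices, and [j.+1] of them have
    degree at most [j.+1 + k].  After division by [j] the claim is linear in
    [j], so the largest [j] allowed by [2 * j.+1 + k <= N] is the worst case;
    there it becomes the hypothesis on [N]. *)
Lemma extremal_bound_ge5 r k N j : 4 < r ->
  k * r.+1 + 4 * r <= N * (r - 3) -> 2 * j.+1 + k <= N ->
  turan_number r (N - j) + j.+1 * (j.+1 + k) <= turan_number r N + k.+1.
Proof.
move=> r4 hN hs.
have r0 : 0 < r by lia.
have := turan_number_increment (N - j) j r0; rewrite subnK; last by lia.
move: (turan_number _ _) (turan_number _ _) => x y incr.
rewrite -(leq_pmul2l (_ : 0 < 2 * r)); last by lia.
suff : 2 * r * (j * (j + k + 2)) <= r.-1 * (j * (2 * (N - j) + j.-1)) by lia.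
clear incr; case: j hs => [|j] hs; first by rewrite !mul0n !muln0.
rewrite mulnCA [leqRHS]mulnCA leq_pmul2l //.
have [q rE] : exists q, r = q + 5 by exists (r - 5); lia.
have [M NE] : exists M, N = M + j.+1 by exists (N - j.+1); lia.
have -> : N - j.+1 = M by lia.
have : (3 * r - 1) * (2 * j.+2 + k) <= (3 * r - 1) * N by rewrite leq_mul2l hs orbT.
have e1 : r - 3 = q + 2 by lia.
have e2 : 3 * r - 1 = 3 * q + 14 by lia.
have e3 : r.-1 = q + 4 by lia.
rewrite e1 in hN; rewrite e2 e3; clear e1 e2 e3 hs.
subst r N => hs; lia.
Qed.

(** For [r = 4] the bound [5 * k + 10] is just enough for the real-valued
    inequality; the rounding error [1/2] is then harmless because both sides
    are integers. *)
Lemma extremal_bound_4 k N j : 5 * k + 10 <= N -> 2 * j.+1 + k <= N ->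
  turan_number 4 (N - j) + j.+1 * (j.+1 + k) <= turan_number 4 N + k.+1.
Proof.
move=> hN hs; have := turan_number_le (N - j) (isT : 0 < 4).
have := turan_number_formula N (isT : 0 < 4).
have : (N %% 4) * (4 - N %% 4) <= 4.
  by have := ltn_pmod N (isT : 0 < 4); case: (N %% 4) => [|[|[|[|]]]].
rewrite -!mulnn /=; have [M NE] : exists M, N = M + j by exists (N - j); lia.
have -> : N - j = M by lia.
have : j * (5 * k + 10) <= j * N by rewrite leq_mul2l hN orbT.
have : 11 * (j * (2 * j.+1 + k)) <= 11 * (j * N) by rewrite !leq_mul2l hs !orbT.
subst N; move: (_ * (4 - _)) (turan_number _ _) (turan_number _ _) => c x y.
lia.
Qed.

Lemma extremal_bound_3 k N j : 4 * j.+1 + 3 * k + 2 <= 2 * N ->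
  turan_number 3 (N - j) + j.+1 * (j.+1 + k) <= turan_number 3 N + k.+1.
Proof.
move=> hs; have := turan_number_le (N - j) (isT : 0 < 3).
have := turan_number_formula N (isT : 0 < 3).
have : (N %% 3) * (3 - N %% 3) <= 2.
  by have := ltn_pmod N (isT : 0 < 3); case: (N %% 3) => [|[|[|]]].
rewrite -!mulnn /=; have [M NE] : exists M, N = M + j by exists (N - j); lia.
have -> : N - j = M by lia.
have : (j * (4 * j.+1 + 3 * k + 2)) <= (j * (2 * N)) by rewrite leq_mul2l hs orbT.
subst N; move: (_ * (3 - _)) (turan_number _ _) (turan_number _ _) => c x y.
lia.
Qed.

(** The range of [s] near half of the vertices, where counting all degrees
    of the low-degree set fully is too wasteful for [r = 3].  Put
    [X = N - k - 2 * s] and [Y = 4 * s + 3 * k + 1 - 2 * N], both nonnegative,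
    so that [k + 1 = 2 * X + Y].  In the variables [s], [X], [Y] the claim
    reduces to [s * (s - 2 * Y - 10) + 4 * Y >= 0], and the bound on [N] reads
    [2 * s >= 9 * X + 5 * Y + 20]. *)
Lemma extremal_bound_3_half k N s b e : 6 * k + 25 <= N ->
  2 * N <= 4 * s + 3 * k + 1 -> 2 * s + k <= N -> b + s = N.+1 ->
  12 * e <= 4 * (b * b) + 4 * (s * b) + 6 * (s * (s + k)) + s * s ->
  e <= turan_number 3 N + k.+1.
Proof.
move=> hN lo hi bE he.
suff : 12 * e <= 12 * turan_number 3 N + 12 * k + 12 by lia.
have := turan_number_formula N (isT : 0 < 3).
have : (N %% 3) * (3 - N %% 3) <= 2.
  by have := ltn_pmod N (isT : 0 < 3); case: (N %% 3) => [|[|[|]]].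
rewrite -!mulnn /=; move: (_ * (3 - _)) (turan_number _ _) => c x hc fx.
suff : 4 * (b * b) + 4 * (s * b) + 6 * (s * (s + k)) + s * s <= 4 * (N * N) + 12 * k + 8 by lia.
clear he fx hc x c e.
have [X NE] : exists X, N = 2 * s + k + X by exists (N - (2 * s + k)); lia.
have [Y kE] : exists Y, k.+1 = 2 * X + Y by exists (k.+1 - 2 * X); lia.
have bX : b = s + k.+1 + X by lia.
have sY : s * (2 * Y + 10) <= s * s by rewrite leq_mul2l; apply/orP; right; lia.
subst b; rewrite kE; clear bE lo hi hN; subst N.
case: Y kE sY => [|Y] kE sY.
  case: X kE sY => [|X] kE sY //.
  have kX : k = 2 * X + 1 by lia.
  by subst k; clear kE; lia.
have kX : k = 2 * X + Y by lia.
by subst k; clear kE; lia.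
Qed.

(** * Edges of a cycle given by a list *)

Section CyclicLists.
Variable T : eqType.
Implicit Types (a b x y : T) (c s w p : seq T).

(** The relation [cycle_edge] on a type without a fixed graph, since the
    graph varies while the cycle is rebuilt. *)
Definition cedge c : rel T :=
  fun x y => [&& x \in c, y \in c & (next c x == y) || (next c y == x)].

Lemma cedgeC c : symmetric (cedge c).
Proof. by move=> x y; rewrite /cedge andbCA orbC. Qed.

Lemma cedge_rot i c : uniq c -> cedge (rot i c) =2 cedge c.
Proof. by move=> uc x y; rewrite /cedge !mem_rot !next_rot. Qed.

Lemma prev_eq c x y : uniq c -> (prev c x == y) = (next c y == x).
Proof.
by move=> uc; apply/eqP/eqP => <-; rewrite ?next_prev ?prev_next.
Qed.

Lemma cedge_rev c : uniq c -> cedge (rev c) =2 cedge c.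
Proof.
by move=> uc x y; rewrite /cedge !mem_rev !next_rev // !prev_eq // orbC.
Qed.

Lemma next_consecutive s1 s2 a b :
  uniq (s1 ++ a :: b :: s2) -> next (s1 ++ a :: b :: s2) a = b.
Proof.
move=> uc; rewrite -(next_rot (size s1)) // rot_size_cat /=.
by rewrite eqxx.
Qed.

Lemma next_last u w : uniq (u :: w) -> next (u :: w) (last u w) = u.
Proof.
by move=> uc; have := cycle_next uc; rewrite /= rcons_path => /andP[_ /eqP].
Qed.

Lemma split_not_last x0 s a : a \in s -> a != last x0 s ->
  exists s1 b s2, s = s1 ++ a :: b :: s2.
Proof.
case/splitPr => s1 [|b s2]; first by rewrite last_cat /= eqxx.
by exists s1, b, s2.
Qed.

Lemma cedge_prefix s1 s2 x p : uniq (s1 ++ x :: p ++ s2) ->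
  path (cedge (s1 ++ x :: p ++ s2)) x p.
Proof.
elim: p x s1 => // y p IH x s1 uc /=; apply/andP; split.
  rewrite /cedge next_consecutive // eqxx !mem_cat !inE !eqxx /=.
  by rewrite !orbT.
by have := IH y (rcons s1 x); rewrite cat_rcons; apply.
Qed.

(** Reversing the tail [y :: w2] of a cyclic list destroys only the edge
    from [last u w1] to [y] and the closing edge from [last y w2] to [u]. *)
Lemma cedge_crossover u w1 y w2 a (c := u :: w1 ++ y :: w2) :
  uniq c -> a \in c -> a != last u w1 -> a != last y w2 ->
  cedge (u :: w1 ++ rev (y :: w2)) a (next c a).
Proof.
rewrite /c => {c} uc ac n1 n2.
set c' := u :: _.
have perm_c : perm_eq c' (u :: w1 ++ y :: w2).
  by rewrite /c' -!cat_cons perm_cat2l perm_rev.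
have uc' : uniq c' by rewrite (perm_uniq perm_c).
have mem_next : next (u :: w1 ++ y :: w2) a \in c'.
  by rewrite (perm_mem perm_c) mem_next.
have ac' : a \in c' by rewrite (perm_mem perm_c).
rewrite /cedge ac' mem_next !andTb.
move: ac; rewrite -cat_cons mem_cat => /orP[] ain.
  have [s1 [b [s2 E]]] := split_not_last ain (n1 : a != last u (u :: w1)).
  have E1 : u :: w1 ++ y :: w2 = s1 ++ a :: b :: (s2 ++ y :: w2).
    by rewrite -cat_cons E -catA.
  have E2 : c' = s1 ++ a :: b :: (s2 ++ rev (y :: w2)).
    by rewrite /c' -cat_cons E -catA.
  rewrite cat_cons E1 E2 !next_consecutive ?eqxx //; first by rewrite -E1.
  by rewrite -E2.
have [s1 [b [s2 E]]] := split_not_last ain (n2 : a != last y (y :: w2)).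
have E1 : u :: w1 ++ y :: w2 = (u :: w1 ++ s1) ++ a :: b :: s2.
  by rewrite -!cat_cons E catA.
have E2 : c' = (u :: w1 ++ rev s2) ++ b :: a :: rev s1.
  rewrite /c' E rev_cat !rev_cons -!cats1 -!catA /=.
  by rewrite -catA.
rewrite cat_cons E1 next_consecutive; last by rewrite -E1.
by rewrite E2 next_consecutive ?eqxx ?orbT // -E2.
Qed.

Lemma path_pairmap (r1 r2 : rel T) (f : T -> T -> T) z x p :
  (forall a b, r1 a b -> f a b != z -> r2 a b) ->
  path r1 x p -> z \notin pairmap f x p -> path r2 x p.
Proof.
move=> h; elim: p x => //= y p IH x /andP[xy py].
by rewrite inE negb_or eq_sym => /andP[fz zp]; rewrite h //= IH.
Qed.

Lemma path_conj (r1 r2 : rel T) x p :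
  path r1 x p -> path r2 x p -> path (fun a b => r1 a b && r2 a b) x p.
Proof.
by elim: p x => //= y p IH x /andP[-> h1] /andP[-> h2] /=; apply: IH.
Qed.

End CyclicLists.

(** * A degree condition for Hamiltonian cycles through a path *)

Section Posa.
Variable V : finType.
Implicit Types (e : rel V) (x u v z : V) (p c w : seq V).

Definition ham_through e x p : Prop :=
  exists2 c, [/\ ucycle e c, 2 < size c & forall y, y \in c]
           & x \in c /\ path (cedge c) x p.

Definition degree e z := #|[set y | e z y]|.

(** Naming an edge of the cycle [c] by its tail makes the edges of a path
    correspond to at most as many vertices. *)
Definition edge_tail c a b : V := if next c a == b then a else b.

(** The classical exchange: a Hamiltonian path from [u] to [v] with
    consecutive vertices [z], [y] such that [u] is adjacent to [y] and [v] to
    [z] closes up to a Hamiltonian cycle that loses only the edge [zy].  The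
    cycle still contains the path [x :: p] when [zy] is not one of its edges. *)
Lemma crossover e u w x p z (c := u :: w) (v := last u w) :
  symmetric e -> irreflexive e -> uniq c -> path e u w ->
  2 < size c -> (forall y, y \in c) -> ~~ e u v ->
  path e x p -> path (cedge c) x p ->
  e u (next c z) -> e v z -> z \notin pairmap (edge_tail c) x p ->
  ham_through e x p.
Proof.
rewrite /v /c => {v c} se ie uc pw sc ac nuv px pcx euz evz zR.
have zv : z != last u w by apply: contraTneq evz => ->; rewrite ie.
have [s1 [y [s2 E]]] := split_not_last (ac z) (zv : z != last u (u :: w)).
have yE : next (u :: w) z = y by rewrite E next_consecutive // -E.
have [w1 [w2 [wE zE]]] : exists w1 w2, w = w1 ++ y :: w2 /\ last u w1 = z.
  case: s1 E => [|a s1] [-> ->]; first by exists [::], s2.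
  by exists (rcons s1 z), s2; rewrite last_rcons cat_rcons.
rewrite yE in euz; subst w.
rewrite last_cat /= in zv nuv evz.
set c' := u :: w1 ++ rev (y :: w2).
have perm_c : perm_eq c' (u :: w1 ++ y :: w2).
  by rewrite /c' -!cat_cons perm_cat2l perm_rev.
move: pw; rewrite cat_path /= => /and3P[pw1 _ pw2].
exists c'; last split.
- split; first (apply/andP; split).
  + rewrite /c' /= rcons_cat cat_path pw1 /= zE -rev_cons.
    rewrite (lastI u (y :: w2)) rev_rcons /= (se z) evz /=.
    have := rev_path e u (y :: w2); rewrite /= => ->.
    rewrite se euz /=.
    by rewrite (eq_path (e' := e)) // => a b; rewrite se.
  + by rewrite (perm_uniq perm_c).
  + by rewrite (perm_size perm_c).
  + by move=> a; rewrite (perm_mem perm_c).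
- by rewrite (perm_mem perm_c).
pose r1 a b := e a b && cedge (u :: w1 ++ y :: w2) a b.
apply: (path_pairmap (r1 := r1) _ _ zR); last exact: path_conj.
have nl : next (u :: w1 ++ y :: w2) (last y w2) = u.
  by rewrite -{2}(next_last uc) last_cat.
have nv a b : e a b -> next (u :: w1 ++ y :: w2) a = b -> a != last y w2.
  move=> eab ab; apply: contraNneq nuv => al.
  have bu : b = u by rewrite -ab al nl.
  by rewrite se -al -bu.
move=> a b /andP[eab] /and3P[acin bcin]; rewrite /edge_tail.
case: eqP => [ab _ az|_ /= /eqP ba bz].
  have := nv a b eab ab; rewrite -ab => n2.
  by apply: cedge_crossover; rewrite // zE.
have := nv b a; rewrite se => /(_ eab ba) n2; rewrite cedgeC -ba.
by apply: cedge_crossover; rewrite // zE.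
Qed.

Lemma complete_path e u w : (forall a b, a != b -> e a b) -> uniq (u :: w) ->
  path e u w.
Proof.
move=> ce; elim: w u => //= y w IH u /andP[uyw uw].
by rewrite IH // andbT ce //; apply: contraNneq uyw => ->; rewrite mem_head.
Qed.

Lemma complete_ham_through e x p : (forall a b, a != b -> e a b) ->
  uniq (x :: p) -> 2 < #|V| -> ham_through e x p.
Proof.
move=> ce up V3; pose q := [seq z <- enum V | z \notin x :: p].
have uc : uniq (x :: p ++ q).
  rewrite -cat_cons cat_uniq up filter_uniq ?enum_uniq // andbT /=.
  by apply/hasPn => z; rewrite mem_filter => /andP[].
have ac y : y \in x :: p ++ q.
  by rewrite -cat_cons mem_cat mem_filter mem_enum /= andbT orbN.
have sc : 2 < size (x :: p ++ q).
  by rewrite -(card_uniqP uc) (eq_card (B := predT)) // => y; rewrite ac.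
exists (x :: p ++ q); last by split; rewrite ?mem_head //; apply: (cedge_prefix (s1 := [::])).
split=> //; rewrite /ucycle uc andbT /= rcons_path complete_path //= ce //.
move: uc sc; case: (p ++ q) => //= y s /andP[xys _] _.
by apply: contraNneq xys => <-; apply: mem_last.
Qed.

Definition add_edge e u v : rel V :=
  fun a b => [|| e a b, (a == u) && (b == v) | (a == v) && (b == u)].

Lemma add_edge_sym e u v : symmetric e -> symmetric (add_edge e u v).
Proof.
move=> se a b; rewrite /add_edge se.
by case: (a == u) (a == v) (b == u) (b == v) => [] [] [] [].
Qed.

(** A cycle that needs the new edge [uv] becomes, after reversal and rotation,
    a Hamiltonian path of the old graph from [u] to [v]. *)
Lemma ham_path_of_add_edge e u v x p : symmetric e -> u != v ->
  ham_through (add_edge e u v) x p ->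
  ham_through e x p \/
  exists w, [/\ path e u w, last u w = v & path (cedge (u :: w)) x p]
    /\ [/\ uniq (u :: w), 2 < size (u :: w) & forall y, y \in u :: w].
Proof.
move=> se uv [c [/andP[cyc uc] sc ac] [_ pc]].
wlog nvu : c cyc uc sc ac pc / (next c u == v) || (next c v == u) ==> (next c v == u).
  move=> H; have [nuv|] := eqVneq (next c u) v; last first.
    by move=> /negPf nuv; apply: (H c); rewrite ?nuv ?implybb.
  apply: (H (rev c)); rewrite ?rev_uniq ?size_rev //.
  - rewrite rev_cycle (eq_cycle (e' := add_edge e u v)) // => a b.
    exact: add_edge_sym.
  - by move=> y; rewrite mem_rev.
  - by rewrite (eq_path (cedge_rev uc)).
  - by rewrite !next_rev // -nuv prev_next // eqxx implybT.
have [nv|nv] := boolP (next c v == u); last first.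
  left; move: nvu; rewrite (negPf nv) orbF implybF => nu.
  exists c => //; split=> //; rewrite /ucycle uc andbT.
  apply: cycle_from_next => // a aC.
  have := next_cycle cyc aC; rewrite /add_edge => /or3P[//||] /andP[/eqP-> h].
    by rewrite h in nu.
  by rewrite h in nv.
right; have [i w E] := rot_to (ac u).
have uw : uniq (u :: w) by rewrite -E rot_uniq.
have lw : last u w = v.
  have := next_last uw; rewrite -E next_rot // => h.
  by apply: (can_inj (prev_next uc)); rewrite h (eqP nv).
have sw : 2 < size (u :: w) by rewrite -E size_rot.
have aw a : a \in u :: w by rewrite -E mem_rot.
exists w; split; split=> //; last by rewrite -E (eq_path (cedge_rot i uc)).
move: cyc; rewrite -(rot_cycle i) E /= rcons_path => /andP[pw _].
  move: uw pw lw sw; case: w {E aw} => //= y w /and3P[uyw yw uw] /andP[uy pw] lw sw.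
  apply/andP; split.
    move: uy; rewrite /add_edge eqxx (negPf uv) /= orbF => /orP[//|/eqP yv].
    case: w lw sw yw {uyw pw uw} => //= z w lw _; rewrite yv -lw.
    by rewrite mem_last.
  apply: (sub_in_path (P := predC1 u) (e := add_edge e u v)) => //.
    move=> a b; rewrite !inE => /negPf au /negPf bu.
    by rewrite /add_edge au bu !andbF !orbF.
  by apply/allP => a aw; rewrite !inE; apply: contraNneq uyw => <-.
Qed.

(** Induction on the number of nonadjacent pairs, the complete graph being
    clear.  Choose nonadjacent [u], [v] with maximal degree sum and
    [degree e u <= degree e v].  Adding the edge [uv] yields a Hamiltonian path
    from [u] to [v].  Let [A] be the set of predecessors on it of the neighbours
    of [u], and [B] the set of neighbours of [v].  If no exchange is possible,
    [A :&: B] has at most [k] elements, one for each edge of the prescribed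
    path.  Hence [degree e u + degree e v < #|V| + k], and by maximality the
    vertices of [A :\: B] have degree at most [degree e u].  There are at
    least [degree e u - k] of them, which contradicts the degree condition; if
    [degree e u <= k], the vertex [u] alone does so for [s = 1]. *)
Lemma posa_condition e k x p : symmetric e -> irreflexive e ->
  path e x p -> uniq (x :: p) -> size p <= k -> k + 3 <= #|V| ->
  (forall s, 0 < s -> 2 * s + k < #|V| ->
     #|[set z | degree e z <= s + k]| < s) ->
  ham_through e x p.
Proof.
move=> se ie px up pk Vk low.
have [m] := ubnP #|[set q : V * V | (q.1 != q.2) && ~~ e q.1 q.2]|.
elim: m e se ie px low => // m IH e se ie px low; rewrite ltnS => em.
pose P (q : V * V) := (q.1 != q.2) && ~~ e q.1 q.2.
have [q0 Pq0|nP] := pickP P; last first.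
  apply: complete_ham_through => //; last by lia.
  by move=> a b ab; have := nP (a, b); rewrite /P /= ab => /negbFE.
pose f (q : V * V) := degree e q.1 + degree e q.2.
have [q Pq qmax] := @arg_maxnP _ q0 P f Pq0.
have [u [v [uv nuv duv mx]]] : exists u v, [/\ u != v, ~~ e u v,
    degree e u <= degree e v &
    forall z, z != v -> ~~ e v z -> degree e z <= degree e u].
  have mx z y : z != y -> ~~ e y z -> degree e z + degree e y <= f q.
    by move=> zy nyz; apply: (qmax (z, y)); rewrite /P /= zy se.
  have /andP[n1 n2] := Pq.
  have [le|/ltnW le] := leqP (degree e q.1) (degree e q.2).
    exists q.1, q.2; split=> // z zq nz.
    by have := mx z _ zq nz; rewrite /f leq_add2r.
  exists q.2, q.1; split=> //; rewrite 1?eq_sym 1?se //.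
  by move=> z zq nz; have := mx z _ zq nz; rewrite /f addnC leq_add2l.
have {IH} ham' : ham_through (add_edge e u v) x p.
  apply: IH => //.
  - exact: add_edge_sym.
  - move=> a; rewrite /add_edge ie /=; have [->|] := eqVneq a u.
      by rewrite (negPf uv).
    by rewrite andbF.
  - by apply: sub_path px => a b eab; rewrite /add_edge eab.
  - move=> s s0 sV; apply: leq_ltn_trans (low s s0 sV).
    apply: subset_leq_card; apply/subsetP => z; rewrite !inE; apply: leq_trans.
    apply: subset_leq_card; apply/subsetP => y; rewrite !inE /add_edge.
    by move=> ->.
  apply: leq_trans em; apply: proper_card; apply/properP; split.
    apply/subsetP => -[a b]; rewrite !inE /= => /andP[->].
    by rewrite /add_edge negb_or => /andP[].
  by exists (u, v); rewrite !inE /= ?uv // /add_edge !eqxx orbT andbF.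
have [//|[w [[pw lw pc] [uw sw ac]]]] := ham_path_of_add_edge se uv ham'.
pose R := pairmap (edge_tail (u :: w)) x p.
have [|nz] := boolP [exists z, [&& e u (next (u :: w) z), e v z & z \notin R]].
  case/existsP => z /and3P[h1 h2 h3].
  by apply: (crossover (u := u) (w := w) (z := z)); rewrite ?lw.
pose A := [set z | e u (next (u :: w) z)].
pose B := [set z | e v z].
have cA : #|A| = degree e u.
  rewrite /degree -(card_preimset [set y | e u y] (can_inj (prev_next uw))).
  by apply: eq_card => z; rewrite !inE.
have cR : #|[set z in R]| <= k.
  by rewrite cardsE (leq_trans (card_size _)) // size_pairmap.
have AB : A :&: B \subset [set z in R].
  apply/subsetP => z; rewrite !inE => /andP[h1 h2].
  by move: nz; rewrite negb_exists => /forallP/(_ z); rewrite h1 h2 /= negbK.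
have nvA : v \notin A :|: B.
  by rewrite !inE ie orbF -{1}lw next_last // ie.
have cU : #|A :|: B| < #|V|.
  by rewrite -cardsT; apply: proper_card; apply/properP; split;
    [apply: subsetT | exists v].
have cAB := leq_trans (subset_leq_card AB) cR.
have cUI := cardsUI A B.
have cB : #|B| = degree e v by [].
have cD : degree e u - k <= #|[set z | degree e z <= degree e u]|.
  rewrite -{1}cA; apply: (@leq_trans #|A :\: B|).
    by rewrite cardsD leq_sub2l.
  apply: subset_leq_card; apply/subsetP => z; rewrite !inE => /andP[nvz Az].
  apply: mx => //; apply: contraTneq Az => ->.
  by rewrite -{1}lw next_last // ie.
have [ku|uk] := ltnP k (degree e u).
  have := low (degree e u - k); rewrite subnK; last exact: ltnW.
  by lia.
have : 0 < #|[set z | degree e z <= 1 + k]|.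
  by apply/card_gt0P; exists u; rewrite inE; lia.
by have := low 1 isT; lia.
Qed.

End Posa.

(** * A low-degree vertex blocks Hamiltonian cycles *)

Section OrientedPaths.
Variable T : eqType.
Implicit Types (x y z v : T) (c p : seq T).

Lemma cedge_path_forward c x y p : uniq c -> uniq (x :: y :: p) ->
  next c x = y -> path (cedge c) y p -> fpath (next c) y p.
Proof.
move=> uc; elim: p x y => //= z p IH x y /andP[xn /andP[yn un]] xy /andP[yz pz].
have yzE : next c y = z.
  case/and3P: yz => _ _ /orP[/eqP //|/eqP zy].
  have zx : z = x by apply: (can_inj (prev_next uc)); rewrite zy.
  by move: xn; rewrite !inE zx eqxx !orbT.
rewrite yzE eqxx /=; apply: (IH y z) => //=.
by rewrite yn.
Qed.

Lemma cedge_path_oriented c x p : uniq c -> uniq (x :: p) ->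
  path (cedge c) x p -> fpath (next c) x p \/ fpath (next (rev c)) x p.
Proof.
case: p => [|y p] uc up; first by left.
rewrite [path _ _ _]/= => /andP[xy py]; case/and3P: (xy) => _ _ /orP[]/eqP h.
  by left; rewrite /= h eqxx; apply: (cedge_path_forward uc up).
have h' : next (rev c) x = y by rewrite next_rev // -h prev_next.
right; rewrite /= h' eqxx; apply: (cedge_path_forward _ up) => //.
  by rewrite rev_uniq.
by rewrite (eq_path (cedge_rev uc)).
Qed.

Lemma cycle_closed c (W : pred T) v : uniq c -> v \in c -> W v ->
  (forall z, W z -> W (next c z)) -> {in c, forall z, W z}.
Proof.
move=> uc vc Wv cl z zc; have [i w E] := rot_to vc.
have := @cycle_next _ (rot i c); rewrite rot_uniq => /(_ uc).
rewrite E /= rcons_path => /andP[pw _].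
have {}pw : fpath (next c) v w.
  by rewrite -(eq_fpath (f := next (v :: w))) // => a; rewrite -E next_rot.
have : z \in v :: w by rewrite -E mem_rot.
elim: w v Wv pw {E vc} => [|y w IH] v Wv /=; first by rewrite inE => _ /eqP->.
case/andP => /eqP vy pw; rewrite inE => /orP[/eqP->//|].
by apply: IH => //; rewrite -vy; apply: cl.
Qed.

Lemma fpath_next_in (f : T -> T) x p z : fpath f x p ->
  z \in x :: p -> z != last x p -> f z \in x :: p.
Proof.
elim: p x => [|y p IH] x /=; first by rewrite inE => _ ->.
case/andP => /eqP xy py; rewrite inE => /orP[/eqP-> _|zin zl].
  by rewrite xy !inE eqxx orbT.
by rewrite inE IH ?orbT.
Qed.

(** The path, being contained in the cycle, follows it in one direction.  Its
    inner vertices have their cycle neighbours on the path, so [v] can only be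
    attached to its two ends, and [v :: x :: p] is closed under [next c]. *)
Lemma short_cycle c x p v : uniq c -> uniq (x :: p) -> v \in c ->
  v \notin x :: p -> path (cedge c) x p ->
  next c v \in x :: p -> prev c v \in x :: p ->
  {subset c <= v :: x :: p}.
Proof.
move=> uc up vc nv pc nx pr.
wlog fp : c uc vc pc nx pr / fpath (next c) x p.
  move=> H; have [|fp] := cedge_path_oriented uc up pc; first exact: H.
  move=> z zc; apply: (H (rev c)); rewrite ?rev_uniq ?mem_rev //.
  - by rewrite (eq_path (cedge_rev uc)).
  - by rewrite next_rev.
  - by rewrite prev_rev.
apply: (@cycle_closed c (mem (v :: x :: p)) v) => //=; first by rewrite mem_head.
move=> z; rewrite inE => /orP[/eqP->|zp]; first by rewrite inE nx orbT.
have pl : prev c v = last x p.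
  by apply: contraNeq nv => /(fpath_next_in fp pr); rewrite next_prev.
have [->|zl] := eqVneq z (last x p); first by rewrite -pl next_prev // mem_head.
by rewrite inE (fpath_next_in fp) ?orbT.
Qed.

End OrientedPaths.

Section Traceable.
Variable G : sgraph.
Implicit Types (A : {set G}) (v x : G) (p : seq G).

Lemma traceable_inducedP A : traceable (induced A) <->
  exists x p, is_path x p /\ A =i x :: p.
Proof.
split=> [[x [p [[px up] ap]]]|[x [p [[px up] Ap]]]].
  exists (val x), (map val p); split; first split.
  - by rewrite path_map.
  - by rewrite -map_cons map_inj_uniq //; apply: val_inj.
  move=> y; rewrite -map_cons; apply/idP/mapP => [yA|[z _ ->]]; last exact: valP.
  by exists (exist _ y yA).
have lift s : {subset s <= A} -> exists s' : seq (induced A), map val s' = s.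
  elim: s => [|y s IH] sA; first by exists [::].
  have [|s' <-] := IH; first by move=> z zs; apply: sA; rewrite inE zs orbT.
  by exists (exist _ y (sA y (mem_head _ _)) :: s').
have [|s] := lift (x :: p); first by move=> y; rewrite Ap.
case: s => // x' p' [xE pE]; exists x', p'; split; first split.
- by move: px; rewrite -xE -pE path_map.
- by move: up; rewrite -xE -pE -map_cons map_inj_uniq //; apply: val_inj.
move=> y; rewrite -(mem_map val_inj) /= xE pE -Ap; exact: valP.
Qed.

(** The path that blocks is a Hamiltonian path of the neighbourhood: a cycle
    through it and through [v] has no room for further vertices. *)
Lemma traceable_nbhd_not_path_hamiltonian v k : #|nbhd v| = k.+1 ->
  k.+2 < #|G| -> traceable (induced (nbhd v)) -> ~ path_hamiltonian k G.
Proof.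
move=> dv Gk /traceable_inducedP[x [p [pathp Np]]] ham.
have up : uniq (x :: p) by case: pathp.
have sp : size p = k.
  by apply/eqP; rewrite -eqSS -dv (eq_card Np) (card_uniqP up).
have [|c [/andP[cyc uc] _ ac] [_ pc]] := ham x p pathp; first by rewrite sp.
have nv : v \notin x :: p by rewrite -Np inE adj_irr.
have sub : {subset c <= v :: x :: p}.
  apply: short_cycle => //; rewrite -Np inE; first exact: next_cycle.
  by rewrite adj_sym; apply: prev_cycle.
have : #|G| <= size (v :: x :: p).
  apply: leq_trans (card_size (v :: x :: p)); apply: subset_leq_card.
  by apply/subsetP => y _; apply: sub; apply: ac.
by rewrite /= sp leqNgt Gk.
Qed.

Lemma arcs_vertex v :
  arcs [set: G] setT = arcs [set~ v] [set~ v] + 2 * #|nbhd v|.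
Proof.
rewrite (arcs_split (subsetT [set v])) !arcs_set1 setTD.
have -> : deg_in [set v] v = 0 by rewrite /deg_in big_set1 adj_irr.
have := deg_in_split v (subsetT [set v]); rewrite setTD deg_in_setT => ->.
have -> : deg_in [set v] v = 0 by rewrite /deg_in big_set1 adj_irr.
by lia.
Qed.

End Traceable.

Lemma arcs_embedding (G H : sgraph) (h : H -> G) : injective h ->
  (forall x y, adj (h x) (h y) = adj x y) ->
  arcs (h @: [set: H]) (h @: [set: H]) = arcs [set: H] setT.
Proof.
move=> ih ah; have ih' : {in [set: H] &, injective h} by move=> x y _ _; apply: ih.
rewrite /arcs /deg_in big_imset //; apply: eq_bigr => x _.
by rewrite big_imset //; apply: eq_bigr => y _; rewrite ah.
Qed.

Lemma num_edges_extremal k n r (G : sgraph) : extremal_family k n r G ->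
  num_edges G = num_edges (turan r n.-1) + k.+1.
Proof.
case=> _ _ [v [[f [g fK gK] fadj] dv _]].
have gadj x y : adj (g x) (g y) = adj x y by rewrite -fadj !gK.
pose h x := val (g x).
have ih : injective h by move=> x y /val_inj/(can_inj gK).
have hT : h @: [set: turan r n.-1] = [set~ v].
  apply/setP => y; apply/imsetP/idP => [[x _ ->]|yv]; first exact: (valP (g x)).
  by exists (f (exist _ y yv)); rewrite ?inE // /h fK.
have := arcs_embedding ih gadj; rewrite hT => e.
by have := handshake G; rewrite (arcs_vertex v) e dv -handshake; lia.
Qed.

(** * A member of the extremal family *)

Section Construction.
Variables (r M : nat) (A : {set 'I_M.+1}).

Definition extend_adj : rel (option 'I_M.+1) := fun x y =>
  match x, y with
  | Some i, Some j => turan_adj r i j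
  | Some i, None | None, Some i => i \in A
  | None, None => false
  end.

Lemma extend_sym : symmetric extend_adj.
Proof. by move=> [i|] [j|] //=; apply: turan_sym. Qed.

Lemma extend_irr : irreflexive extend_adj.
Proof. by move=> [i|] //=; apply: turan_irr. Qed.

Definition extend_turan : sgraph := SGraph extend_sym extend_irr.

Lemma extend_turan_induced :
  isomorphic (induced [set~ (None : extend_turan)]) (turan r M.+1).
Proof.
pose f (x : induced [set~ (None : extend_turan)]) : turan r M.+1 :=
  odflt ord0 (val x).
exists f; last first.
  by move=> [[i|] hi] [[j|] hj] //=;
    (have := hi; have := hj; rewrite !inE).
have gP (i : 'I_M.+1) : Some i \in [set~ (None : extend_turan)] by rewrite !inE.
exists (fun i => exist _ (Some i) (gP i)) => //.
by move=> [[i|] hi]; [apply: val_inj | have := hi; rewrite !inE].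
Qed.

(** The new vertex can be put into the residue class [r.-1], so that the graph
    is still [r]-partite. *)
Lemma extend_turan_clique_free : 0 < r -> {in A, forall i : 'I_M.+1, i %% r != r.-1} ->
  clique_free r.+1 extend_turan.
Proof.
move=> r0 hA B cB Br.
pose col (x : extend_turan) : 'I_r :=
  Ordinal (ltn_pmod (if x is Some i then i : nat else r.-1) r0).
have pr : r.-1 %% r = r.-1 by rewrite modn_small // prednK.
have col_adj (x y : extend_turan) : adj x y -> col x != col y.
  rewrite -val_eqE; case: x y => [i|] [j|] //= /hA; first by rewrite pr.
  by rewrite pr eq_sym.
have inj : {in B &, injective col}.
  move=> x y xB yB e; apply/eqP; apply: contraTT isT => ne.
  by have := col_adj _ _ (cB _ _ xB yB ne); rewrite e eqxx.
have := max_card (mem (col @: B)); rewrite card_in_imset // Br card_ord.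
by rewrite ltnn.
Qed.

End Construction.

Lemma path_iota (e : rel nat) j m :
  (forall t, j <= t < j + m -> e t t.+1) -> path e j (iota j.+1 m).
Proof.
elim: m j => //= m IH j h; rewrite h ?IH //; first by move=> t ht; apply: h; lia.
by lia.
Qed.

(** The [k.+1] neighbours are the first vertices outside the residue class
    [r.-1], in increasing order.  Since at least two classes remain, consecutive
    ones lie in different classes, and they form a path. *)
Lemma extremal_family_nonempty k r M : 2 < r -> k + k %/ r.-1 <= M ->
  exists G : sgraph, extremal_family k M.+2 r G.
Proof.
move=> r2 kM.
(* a t is the t-th natural number not congruent to r.-1 modulo r *)
pose a t := t + t %/ r.-1.
have a_mono s t : s < t -> a s < a t.
  by move=> st; rewrite /a -addSn leq_add // leq_div2r // ltnW.
have a_inj : injective a.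
  by move=> s t e; case: (ltngtP s t) => // /a_mono; rewrite e ltnn.
have a_mod t : a t %% r = t %% r.-1.
  have -> : a t = t %/ r.-1 * r + t %% r.-1.
    rewrite /a {1}(divn_eq t r.-1); have : r = r.-1.+1 by lia.
    by move=> {2}->; lia.
  rewrite modnMDl modn_small //; have := ltn_pmod t (_ : 0 < r.-1); lia.
have a_lt t : t <= k -> a t < M.+1.
  by move=> tk; rewrite ltnS (leq_trans _ kM) // leq_add // leq_div2r.
pose b t : 'I_M.+1 := inord (a t).
have bE t : t <= k -> b t = a t :> nat by move=> tk; rewrite inordK // a_lt.
pose A : {set 'I_M.+1} := [set i | i \in map b (iota 0 k.+1)].
have AP i : i \in A -> exists2 t, t <= k & i = b t.
  by rewrite inE => /mapP[t]; rewrite mem_iota => tk ->; exists t => //; lia.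
pose G := extend_turan r A; exists G.
pose g t : G := Some (b t).
have nbhdE : nbhd (None : G) =i map g (iota 0 k.+1).
  move=> [i|]; rewrite inE [LHS]/=; last by apply/esym/mapP => -[].
  rewrite inE; apply/mapP/mapP => [[t ti ->]|[t ti [->]]]; exists t => //.
have un : uniq (map g (iota 0 k.+1)).
  rewrite map_inj_in_uniq ?iota_uniq // => s t; rewrite !mem_iota => sk tk [e].
  by apply: a_inj; rewrite -!bE ?e; lia.
split; first by rewrite card_option card_ord.
  apply: extend_turan_clique_free => [|i /AP[t tk ->]]; first by lia.
  rewrite bE // a_mod; have := ltn_pmod t (_ : 0 < r.-1); lia.
exists None; split; first exact: extend_turan_induced.
  by rewrite (eq_card nbhdE) (card_uniqP un) size_map size_iota.
apply/traceable_inducedP; exists (g 0), (map g (iota 1 k)).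
split=> //; split=> //.
rewrite path_map; apply: path_iota => t /andP[_ tk] /=.
rewrite /turan_adj !bE; [|lia|lia].
rewrite !a_mod -addn1 -modnDml.
have := ltn_pmod t (_ : 0 < r.-1); move: (t %% r.-1) => q hq.
have {}hq : q < r.-1 by apply: hq; lia.
move: hq; rewrite leq_eqVlt => /orP[/eqP e|lt].
  by rewrite -e addn1 modnn; lia.
by rewrite modn_small; lia.
Qed.

(** * The extremal number *)

Definition nat_order_bound (r k n : nat) : bool :=
  if r == 3 then 6 * k + 26 <= n
  else if r <= 7 then 5 * k + 11 <= n
  else (k + 5) * (r - 4) + 4 * (k + 4) <= n * (r - 4).

Lemma order_bound_nat r k n :
  (order_bound r k <= n%:R)%R = nat_order_bound r k n.
Proof.
rewrite /order_bound /nat_order_bound.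
case: ifP => _; first by rewrite -natrM -natrD ler_nat.
case: leqP => r7; first by rewrite -natrM -natrD ler_nat.
rewrite -(natrB _ (_ : 4 <= r)); last by lia.
rewrite -!natrD -natrM addrC -lerBrDr.
rewrite ler_pdivrMr; last by rewrite ltr0n subn_gt0; lia.
by rewrite mulrBl lerBrDr -!natrM -natrD ler_nat addnC.
Qed.

Lemma extremal_bound r k N s : 3 < r -> nat_order_bound r k N.+1 -> 0 < s ->
  2 * s + k <= N ->
  turan_number r (N.+1 - s) + s * (s + k) <= turan_number r N + k.+1.
Proof.
rewrite /nat_order_bound; case: s => // s r3; rewrite subSS.
have -> : (r == 3) = false by lia.
case: ifP => r7 hN _ hs.
  have [r4|r4] := leqP r 4.
    have -> : r = 4 by lia.
    by apply: extremal_bound_4; lia.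
  apply: extremal_bound_ge5 => //.
  have [q [-> q1 q4]] : exists q, [/\ r = q + 3, 2 <= q & q <= 4].
    by exists (r - 3); split; lia.
  rewrite addnK; apply: leq_trans (_ : (5 * k + 10) * q <= _).
    by case: q q1 q4 => [|[|[|[|[|]]]]] //; lia.
  by rewrite leq_mul2r -ltnS; apply/orP; right; lia.
apply: extremal_bound_ge5 => //; first by lia.
have [q rE] : exists q, r = q + 8 by exists (r - 8); lia.
have e1 : r - 4 = q + 4 by lia.
have e2 : r - 3 = q + 5 by lia.
rewrite e1 in hN; rewrite e2; subst r; clear e1 e2 hs.
have [M NE] : exists M, N = M + k + 4.
  exists (N - k - 4); nia.
by subst N; nia.
Qed.

Lemma exact_subset (T : finType) (A : {set T}) s : s <= #|A| ->
  exists2 S : {set T}, S \subset A & #|S| = s.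
Proof.
move=> sA; exists [set x in take s (enum A)].
  by apply/subsetP => x; rewrite inE => /mem_take; rewrite mem_enum.
rewrite cardsE (card_uniqP _) ?take_uniq ?enum_uniq // size_takel //.
by rewrite -cardE.
Qed.

(** The general estimate suffices except for [r = 3] and [s] close to half of
    the vertices. *)
Lemma many_low_degree_edges (G : sgraph) r k s : 2 < r ->
  nat_order_bound r k #|G| -> clique_free r.+1 G -> 0 < s -> 2 * s + k < #|G| ->
  s <= #|[set z : G | #|nbhd z| <= s + k]| ->
  num_edges G <= turan_number r #|G|.-1 + k.+1.
Proof.
move=> r2 hN free s0 sG /exact_subset[S /subsetP sub Ss].
have low : {in S, forall v : G, #|nbhd v| <= s + k}.
  by move=> v /sub; rewrite inE.
have r0 : 0 < r by lia.
have := low_degree_edges r0 free low; rewrite Ss => le1.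
case NE : #|G| => [|N]; first by rewrite NE in sG.
rewrite NE /= in hN sG le1 *.
have [r3|r3] := ltnP 3 r.
  by apply: leq_trans le1 _; apply: extremal_bound.
have rE : r = 3 by lia.
subst r; have {}hN : 6 * k + 25 <= N by move: hN; rewrite /nat_order_bound /=; lia.
have [small|big] := leqP (4 * s + 3 * k + 2) (2 * N).
  apply: leq_trans le1 _; case: s s0 small {Ss low sub sG} => // s _ small.
  by rewrite subSS; apply: extremal_bound_3.
have := low_degree_edges_K4 free low.
have SC : #|~: S| = N.+1 - s by rewrite cardsCs setCK NE Ss.
rewrite SC Ss; apply: extremal_bound_3_half => //; lia.
Qed.

Theorem theorem5p5 (r k n : nat) (hr : 3 <= r)
  (hn : (order_bound r k <= n%:R)%R) :
  [/\ forall G : sgraph, #|G| = n -> clique_free r.+1 G ->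
        ~ path_hamiltonian k G ->
        num_edges G <= num_edges (turan r n.-1) + k.+1,
      exists G : sgraph, extremal_family k n r G
    & forall G : sgraph, extremal_family k n r G ->
        ~ path_hamiltonian k G /\
        num_edges G = num_edges (turan r n.-1) + k.+1].
Proof.
move: hn; rewrite order_bound_nat => hn; have r0 : 0 < r by lia.
have kn : k + 5 <= n.
  move: hn; rewrite /nat_order_bound; case: ifP => _; first by lia.
  case: ifP => r7; first by lia.
  have : 0 < r - 4 by lia.
  by move: (r - 4) => q q0; nia.
split.
- move=> G Gn free nham; subst n; rewrite num_edges_turan //.
  have [//|big] := leqP (num_edges G) (turan_number r #|G|.-1 + k.+1).
  case: nham => x p [px up] pk.
  apply: (posa_condition (@adj_sym G) (@adj_irr G) px up pk).
    by lia.
  move=> s s0 sG; rewrite ltnNge; apply: contraL big => many; rewrite -leqNgt.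
  by apply: (@many_low_degree_edges G r k s).
- have -> : n = n.-2.+2 by lia.
  apply: extremal_family_nonempty => //.
  have dk : k %/ r.-1 * r.-1 <= k := leq_trunc_div _ _.
  move: hn dk; rewrite /nat_order_bound; case: ifP => _.
    by have := leq_div k r.-1; lia.
  case: ifP => r7; first by have := leq_div k r.-1; lia.
  have [q rE] : exists q, r = q + 8 by exists (r - 8); lia.
  move: (k %/ _) => d; have -> : r - 4 = q + 4 by lia.
  have -> : r.-1 = q + 7 by lia.
  move=> hn dk; rewrite leqNgt; apply/negP => lt.
  have : n * (q + 4) <= (k + d + 1) * (q + 4) by rewrite leq_mul2r; lia.
  lia.
move=> G ext; split; last exact: num_edges_extremal.
case: ext => Gn _ [v [_ dv tr]].
by apply: traceable_nbhd_not_path_hamiltonian dv _ tr; rewrite Gn; lia.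
Qed.
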